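(* Let $n\ge1$ be an integer and let $c,\ell,c_1,\ldots,c_n$ be positive real numbers. Let $B\in\mathbb{R}^{n\times n}$ and $A_0\in\mathbb{R}^{(3n+2)\times(3n+2)}$ be the matrices defined in the context, with $F=\mathrm{diag}(c/c_1,\ldots,c/c_n)$, and let $\omega_0=(\sqrt{\ell c})^{-1}$. Then the matrix $I+BF$ has $n$ real positive eigenvalues (counted with multiplicity). Moreover, denoting by $a_1^2,\ldots,a_n^2$ (with $a_k>0$) these $n$ real positive eigenvalues and fixing $a_0=1$, the matrix $A_0$ has $n$ eigenvalues at $s=0$ having $n$ linearly independent eigenvectors, and $n+1$ pairs of purely imaginary conjugate eigenvalues at $s=\pm\jmath\,\omega_0 a_k$, $k=0,\ldots,n$ (eigenvalues being counted with multiplicity, where $\jmath$ is the imaginary unit).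
   Context: The matrix $B\in\mathbb{R}^{n\times n}$ is the symmetric tridiagonal matrix with all super- and sub-diagonal entries equal to $-1$, with diagonal entries $B_{ii}=2$ for $i=1,\ldots,n-1$ and $B_{nn}=\frac{n+1}{n}$, and all other entries equal to zero (for $n=1$, $B=[2]$). The matrix $A_0$ is the state matrix of the linear model $\dot x=A_0x$ of the $n$-stage Marx generator circuit, an $LC$ ladder network with $n$ storage capacitors $c$, $n$ inductors $\ell$, $n$ vertical capacitors $c_1,\ldots,c_n$, and a last loop with inductor $n\ell$ and load capacitor $c/n$. The state is $x=[v_{c1},\ldots,v_{cn},v_1,\ldots,v_n,v_{n+1},i_1,\ldots,i_n,i_L]^T$ ($v_{ck}$: voltages of the vertical capacitors; $v_1,\ldots,v_n$: voltages of the storage capacitors; $n v_{n+1}$: voltage of the load capacitor; $i_1,\ldots,i_n,i_L$: inductor currents). Explicitly, $$A_0=\begin{bmatrix} 0_{n\times n} & 0_{n\times(n+1)} & -\frac1c F\Sigma J_{-1}\\ 0_{(n+1)\times n} & 0_{(n+1)\times(n+1)} & \frac1c I_{n+1}\\ \frac1\ell J_{n+1}^{-1}J_{-1}\Sigma^T & -\frac1\ell I_{n+1} & 0_{(n+1)\times(n+1)}\end{bmatrix},$$ where $I_q$ is the identity matrix of size $q$, $J_{n+1}=\mathrm{diag}(1,\ldots,1,n)\in\mathbb{R}^{(n+1)\times(n+1)}$, $J_{-1}=\mathrm{diag}(1,\ldots,1,-1)\in\mathbb{R}^{(n+1)\times(n+1)}$, and $\Sigma\in\mathbb{R}^{n\times(n+1)}$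 has entries $\Sigma_{i,i}=1$, $\Sigma_{i,i+1}=-1$ for $i=1,\ldots,n$ and zeros elsewhere. *)

(* Defs.v *)
From mathcomp Require Import all_boot all_order all_algebra.
From mathcomp Require Import reals complex.

Set Implicit Arguments.
Unset Strict Implicit.
Unset Printing Implicit Defensive.

Import Order.TTheory GRing.Theory Num.Theory.
Local Open Scope ring_scope.

Section Spectrum.
Variables (K : fieldType) (m : nat).

(* [s] lists all the eigenvalues of [A], each repeated according to its
   algebraic multiplicity; in particular [A] has no other eigenvalue in any
   extension of [K], and [size s = m]. *)
Definition has_eigenvalues (A : 'M[K]_m) (s : seq K) : Prop :=
  char_poly A = \prod_(x <- s) ('X - x%:P).

(* Column eigenvectors, unlike the library's [eigenspace], which consists of
   row vectors. *)
Definition eigenvector (A : 'M[K]_m) (s : K) (x : 'cV[K]_m) : Prop :=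
  x != 0 /\ A *m x = s *: x.

End Spectrum.

Section Marx.
Variables (R : realType) (n : nat).

(* Indices are 0-based, so that the last row of [B] is the one with
   [i.+1 = n] and the last index of ['I_n.+1] is [ord_max]. *)
Definition Bmx : 'M[R]_n :=
  \matrix_(i, j)
    if i == j then (if i.+1 == n then n.+1%:R / n%:R else 2)
    else if (i.+1 == j) || (j.+1 == i) then -1 else 0.

Definition Fmx (c : R) (cv : 'I_n -> R) : 'M[R]_n :=
  diag_mx (\row_k (c / cv k)).

Definition Sigma : 'M[R]_(n, n.+1) :=
  \matrix_(i, j)
    if j == i :> nat then 1 else if j == i.+1 :> nat then -1 else 0.

Definition Jlast (d : R) : 'M[R]_n.+1 :=
  diag_mx (\row_j if j == ord_max then d else 1).

(* State ordering: the n vertical capacitor voltages, then the n+1 voltages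
   v_1, ..., v_(n+1), then the n+1 currents; the order is 3n+2. *)
Definition A0 (c l : R) (cv : 'I_n -> R) : 'M[R]_(n + (n.+1 + n.+1)) :=
  let Jn := Jlast n%:R in
  let Jm := Jlast (-1) in
  block_mx
    0
    (row_mx 0 (- (c^-1 *: (Fmx c cv *m Sigma *m Jm))))
    (col_mx 0 (l^-1 *: (invmx Jn *m Jm *m Sigma^T)))
    (block_mx 0                 (c^-1 *: 1%:M)
              (- (l^-1 *: 1%:M)) 0).

Definition A0C (c l : R) (cv : 'I_n -> R) : 'M[R[i]]_(n + (n.+1 + n.+1)) :=
  map_mx (real_complex R) (A0 c l cv).

End Marx.

Definition omega0 (R : realType) (c l : R) : R := (Num.sqrt (l * c))^-1.

(* Main.v *)
Require Import Defs.
From mathcomp Require Import all_boot all_order all_algebra.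
From mathcomp Require Import reals complex.
From mathcomp Require Import ring.

(** Eliminating the voltages from [s x = A0 x] leaves, for the inductor currents,
    the equation [(s^2 + omega0^2 (1 + Q P)) i = 0] with [P = F Sigma J'] and
    [Q = J^-1 J' Sigma^T], where [J = diag(1, ..., 1, n)] and
    [J' = diag(1, ..., 1, -1)] ([char_poly_second_order]). Here [Q P] has size
    [n + 1] and [P Q] has size [n]; by [det_scalar_addmxC] the spectrum of [Q P]
    is that of [P Q] together with one extra zero. Since [J'] squares to the
    identity, [P Q = F Sigma J^-1 Sigma^T], and [Sigma J^-1 Sigma^T] is exactly
    [B] ([Bmx_factor]), so [P Q] is the transpose of [B F]. Therefore
    [char_poly A0 = 'X^n * \prod_k ('X^2 + omega0^2 a_k^2)], with [a_0 = 1] coming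
    from the extra zero ([char_poly_A0]), and each quadratic factor splits over
    the complex numbers as a conjugate pair.

    The same factorization of [B] shows that its quadratic form is nonnegative, so
    a Rayleigh quotient makes every complex eigenvalue of [B F] real and
    nonnegative ([eigenvalue_gram_diag_ge0]); adding [1] makes them positive.
    The kernel of [A0] is written down explicitly ([A0_kernel]). *)

Set Implicit Arguments.
Unset Strict Implicit.
Unset Printing Implicit Defensive.

Import Order.TTheory GRing.Theory Num.Theory.
Local Open Scope ring_scope.

(** * Determinants and characteristic polynomials *)

(** The Weinstein-Aronszajn identity. The determinant of the block matrix [N]
    below can be found by clearing either of its off-diagonal blocks; the powers
    of [y] avoid inverting [y]. *)
Lemma det_scalar_addmxC {R : comNzRingType} {m n : nat} (y : R)
    (P : 'M[R]_(n, m)) (Q : 'M[R]_(m, n)) :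
  y ^+ n * \det (y%:M + Q *m P) = y ^+ m * \det (y%:M + P *m Q).
Proof.
pose N : 'M_(n + m) := block_mx y%:M P (- Q) 1%:M.
have NP : \det N = \det (y%:M + P *m Q).
  have /(congr1 determinant) : N *m block_mx 1%:M 0 Q 1%:M =
      block_mx (y%:M + P *m Q) P 0 1%:M.
    rewrite mulmx_block !mulmx1 !mul1mx !mulmx0 !add0r.
    by rewrite addNr.
  by rewrite det_mulmx det_lblock det_ublock !det1 !mulr1.
have /(congr1 determinant) : block_mx 1%:M 0 Q y%:M *m N =
    block_mx y%:M P 0 (y%:M + Q *m P).
  rewrite mulmx_block !mulmx1 !mul1mx !mul0mx !addr0 mul_mx_scalar.
  by rewrite mul_scalar_mx scalerN subrr [Q *m P + _]addrC.
by rewrite det_mulmx det_lblock det_ublock !det_scalar expr1n mul1r NP.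
Qed.

(** Eliminating the first two blocks of [s x = A x] leaves the second-order
    system [(s^2 + a b + Q P) i = 0] in the last block. On determinants the
    elimination is a right multiplication by the block upper triangular [T],
    whose last column cancels the upper right blocks of [s - A]; [T] has
    determinant a power of ['X], which is divided out at the end. *)
Lemma char_poly_second_order {K : idomainType} {m n : nat} (a b : K)
    (P : 'M[K]_(n, m)) (Q : 'M[K]_(m, n)) :
  char_poly (block_mx 0 (row_mx 0 (- P)) (col_mx 0 Q)
               (block_mx 0 a%:M (- b%:M) 0) : 'M_(n + (m + m))) =
  'X^n * \det (('X^2 + (a * b)%:P)%:M + map_mx polyC (Q *m P)).
Proof.
set A := (X in char_poly X).
have charE : char_poly_mx A =
    block_mx 'X%:M (row_mx 0 (map_mx polyC P)) (col_mx 0 (- map_mx polyC Q))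
      (block_mx 'X%:M (- a%:P%:M) b%:P%:M 'X%:M).
  rewrite /char_poly_mx /A map_block_mx map_row_mx map_col_mx map_block_mx.
  rewrite !map_mx0 !map_mxN !map_scalar_mx /= !scalar_mx_block.
  rewrite !opp_block_mx opp_row_mx opp_col_mx !add_block_mx !opprK.
  by rewrite !oppr0 !addr0 !add0r.
pose T : 'M[{poly K}]_(n + (m + m)) :=
  block_mx 'X%:M (row_mx 0 (- map_mx polyC P)) 0
    (block_mx 'X%:M a%:P%:M 0 'X%:M).
have : char_poly_mx A *m T =
    block_mx ('X^2)%:M 0 (col_mx 0 (- ('X *: map_mx polyC Q)))
      (block_mx ('X^2)%:M 0 ('X *: b%:P%:M)
         (('X^2 + (a * b)%:P)%:M + map_mx polyC (Q *m P))).
  rewrite charE /T mulmx_block mulmx0 addr0 -scalar_mxM -expr2.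
  congr block_mx.
  - rewrite mul_scalar_mx scale_row_mx scaler0 mul_row_block.
    rewrite !mul0mx !mulmx0 !add0r mul_mx_scalar add_row_mx add0r.
    by rewrite scalerN addNr row_mx0.
  - by rewrite mulmx0 addr0 mul_col_mx mul0mx mulNmx mul_mx_scalar.
  - rewrite mulmx_block mul_col_row !mul0mx !mulmx0 !addr0 mulNmx mulmxN opprK.
    rewrite add_block_mx !add0r -!scalar_mxM -expr2 mul_mx_scalar.
    rewrite -(map_mxM polyC) -scale_scalar_mx scalerN subrr.
    rewrite mulrC scale_scalar_mx; congr block_mx.
    by rewrite addrC [_ + ('X^2)%:M]addrC -polyCM -raddfD mulrC.
move/(congr1 determinant).
rewrite det_mulmx /T det_ublock det_ublock det_lblock det_lblock !det_scalar.
have X0 k : ('X : {poly K}) ^+ k != 0 by rewrite expf_neq0 // polyX_eq0.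
move=> E; apply: (mulIf (X0 (n + (m + m))%N)).
rewrite /char_poly [X in _ * X]exprD [X in _ * (_ * X)]exprD E.
by rewrite -!exprM !mul2n -!addnn !exprD; ring.
Qed.

(** The left side is [char_poly A] evaluated at [- u / w], up to the factor
    [(- w) ^+ n]. *)
Lemma det_of_spectrum {K : fieldType} {n : nat} (A : 'M[K]_n) (s : seq K)
    (w : K) (u : {poly K}) :
  w != 0 -> has_eigenvalues A s ->
  \det (u%:M + map_mx polyC (w *: A)) = \prod_(x <- s) (u + (w * x)%:P).
Proof.
move=> w0 sA.
have szs : size s = n.
  by apply: succn_inj; rewrite -(size_char_poly A) sA size_prod_XsubC.
pose q := - (w^-1 *: u).
have qE : (- w) *: q = u.
  by rewrite /q scalerN scaleNr opprK scalerA divff ?scale1r.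
have comp_det : char_poly A \Po q = \det (q%:M - map_mx polyC A).
  rewrite /char_poly -[LHS]/(comp_poly q _) -det_map_mx; congr determinant.
  rewrite /char_poly_mx map_mxB map_scalar_mx /= comp_polyX; congr (_ - _).
  by apply/matrixP=> i j; rewrite !mxE /= comp_polyC.
have -> : u%:M + map_mx polyC (w *: A) =
    (- w)%:P *: (q%:M - map_mx polyC A).
  rewrite scalerBr scale_scalar_mx mul_polyC qE polyCN scaleNr opprK.
  by rewrite map_mxZ.
rewrite detZ -comp_det sA rmorph_prod /= -szs.
elim: s {sA szs} => [|x s IHs]; first by rewrite !big_nil mulr1.
rewrite !big_cons exprS mulrACA IHs; congr (_ * _).
by rewrite comp_polyB comp_polyX comp_polyC mul_polyC scalerBr qE -mul_polyC
  -polyCM mulNr polyCN opprK.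
Qed.

(** * The matrices of the ladder network *)

Lemma Sigma_mulE {R : realType} {n p : nat} (A : 'M[R]_(n.+1, p)) i k :
  (Sigma R n *m A) i k = A (widen_ord (leqnSn n) i) k - A (lift ord0 i) k.
Proof.
rewrite mxE (bigD1 (widen_ord (leqnSn n) i)) //=.
rewrite (bigD1 (lift ord0 i)) /=; last first.
  by rewrite -val_eqE /= /bump leq0n add1n neq_ltn ltnSn orbT.
rewrite big1 ?addr0 => [|j /andP[/negPf jw /negPf jl]]; last first.
  move: jw jl; rewrite mxE -!val_eqE /= /bump leq0n add1n => -> ->.
  by rewrite mul0r.
rewrite !mxE /= /bump leq0n add1n !eqxx mul1r.
by rewrite gtn_eqF // mulN1r.
Qed.

Lemma Jlast_unit {R : realType} {n : nat} (d : R) :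
  d != 0 -> Jlast n d \in unitmx.
Proof.
move=> d0; rewrite unitmxE det_diag unitfE prodf_seq_neq0.
by apply/allP=> j _; rewrite mxE; case: ifP; rewrite ?oner_eq0.
Qed.

Lemma mul_Jlast {R : realType} {n : nat} (d e : R) :
  Jlast n d *m Jlast n e = Jlast n (d * e).
Proof.
rewrite mulmx_diag; congr diag_mx; apply/rowP=> j; rewrite !mxE.
by case: ifP; rewrite ?mulr1.
Qed.

Lemma Jlast1 {R : realType} {n : nat} : Jlast n (1 : R) = 1%:M.
Proof.
by rewrite -diag_const_mx; congr diag_mx; apply/rowP=> j; rewrite !mxE if_same.
Qed.

Lemma invmx_Jlast {R : realType} {n : nat} (d : R) :
  d != 0 -> invmx (Jlast n d) = Jlast n d^-1.
Proof.
move=> d0; rewrite -[LHS]mulmx1 -[in LHS]Jlast1 -(divff d0) -mul_Jlast.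
by rewrite mulmxA mulVmx ?mul1mx ?Jlast_unit.
Qed.

(** [B] is a weighted Gram matrix: the last weight [1 / n] accounts for the
    exceptional corner [(n + 1) / n = 1 + 1 / n]. *)
Lemma Bmx_factor {R : realType} {n : nat} :
  Bmx R n = Sigma R n *m Jlast n n%:R^-1 *m (Sigma R n)^T.
Proof.
apply/matrixP=> i k; rewrite -mulmxA Sigma_mulE mul_diag_mx !mxE.
rewrite -!val_eqE /= /bump leq0n add1n (ltn_eqF (ltn_ord i)) mul1r eqSS.
have n0 : n%:R != 0 :> R.
  by rewrite pnatr_eq0 -lt0n (leq_ltn_trans _ (ltn_ord i)).
case: (eqVneq (i : nat) k) => [->|_].
  rewrite (gtn_eqF (ltnSn k)) mulrN1 opprK; case: ifP => _ //.
  by rewrite -natr1; field.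
case: (eqVneq i.+1 (k : nat)) => [ik|_] /=.
  by rewrite -ik (ltn_eqF (leqnSn i.+1)) ik (ltn_eqF (ltn_ord k)) mulr1 sub0r.
by rewrite mulr0 subr0 [_ == i :> nat]eq_sym.
Qed.

(** * The spectrum of 1 + B F *)

Section Rayleigh.
Variable C : numClosedFieldType.

Lemma weighted_norm_ge0 n (d : 'rV[C]_n) (v : 'rV[C]_n) :
  (forall j, 0 <= d 0 j) ->
  0 <= (v *m diag_mx d *m map_mx Num.conj v^T) 0 0.
Proof.
move=> d0; rewrite mul_mx_diag mxE sumr_ge0 // => j _.
by rewrite !mxE mulrAC -normCK mulr_ge0 ?exprn_ge0.
Qed.

Lemma weighted_norm_gt0 n (d : 'rV[C]_n) (v : 'rV[C]_n) :
  (forall j, 0 < d 0 j) -> v != 0 ->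
  0 < (v *m diag_mx d *m map_mx Num.conj v^T) 0 0.
Proof.
move=> d0 v0; have [j vj] := rV0Pn _ v0.
rewrite mul_mx_diag mxE (bigD1 j) //= ltr_pwDl ?sumr_ge0 // => [|k _].
  by rewrite !mxE mulrAC -normCK mulr_gt0 ?exprn_gt0 ?normr_gt0.
by rewrite !mxE mulrAC -normCK mulr_ge0 ?exprn_ge0 // ltW.
Qed.

(** A Rayleigh quotient: if [v S D S^* F = z v], multiplying on the right by
    [F^-1 v^*] exhibits [z] as the quotient of the weighted square norms of
    [v S] (weight [D]) and of [v] (weight [F^-1]). This makes the real spectrum
    visible without symmetrizing the product by a square root of [F]. *)
Lemma eigenvalue_gram_diag_ge0 m n (S : 'M[C]_(n, m)) (d : 'rV[C]_m)
    (f : 'rV[C]_n) (z : C) :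
  (forall j, 0 <= d 0 j) -> (forall i, 0 < f 0 i) ->
  eigenvalue (S *m diag_mx d *m map_mx Num.conj S^T *m diag_mx f) z -> 0 <= z.
Proof.
move=> d0 f0 /eigenvalueP[v vE v0].
pose g := \row_i (f 0 i)^-1.
have fg : diag_mx f *m diag_mx g = 1%:M.
  rewrite mulmx_diag -diag_const_mx; congr diag_mx.
  by apply/rowP=> i; rewrite !mxE divff ?gt_eqF.
have /(congr1 (fun A : 'M_1 => A 0 0)) :
    (v *m S) *m diag_mx d *m map_mx Num.conj (v *m S)^T =
    z *: (v *m diag_mx g *m map_mx Num.conj v^T).
  rewrite trmx_mul map_mxM 2!scalemxAl -vE !mulmxA.
  by rewrite -[_ *m diag_mx f *m diag_mx g]mulmxA fg mulmx1.
rewrite [RHS]mxE => E.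
have g0 : 0 < (v *m diag_mx g *m map_mx Num.conj v^T) 0 0.
  by apply: weighted_norm_gt0 => // i; rewrite mxE invr_gt0.
by rewrite -(pmulr_lge0 _ g0) -E weighted_norm_ge0.
Qed.

End Rayleigh.

(** Over [R[i]] the characteristic polynomial splits; as all its roots are real,
    the factorization descends to [R]. *)
Lemma split_of_positive_spectrum {R : realType} {n : nat} (A : 'M[R]_n) :
  (forall z, eigenvalue (map_mx (real_complex R) A) z -> 0 < z) ->
  exists s : n.-tuple R, has_eigenvalues A s /\ (forall x, x \in s -> 0 < x).
Proof.
move=> Apos.
have [r rE] :=
  closed_field_poly_normal (char_poly (map_mx (real_complex R) A)).
rewrite (monicP (char_poly_monic _)) scale1r in rE.
have r_gt0 z : z \in r -> 0 < z.
  by move=> zr; apply: Apos; rewrite eigenvalue_root_char rE root_prod_XsubC.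
have r_real z : z \in r -> ((complex.Re z)%:C)%C = z.
  by move=> /r_gt0/gtr0_real/RRe_real.
have sE : has_eigenvalues A (map (@complex.Re R) r).
  apply: (map_poly_inj (real_complex R)).
  rewrite map_char_poly rE rmorph_prod big_map; apply: eq_big_seq => z zr.
  by rewrite rmorphB /= map_polyX map_polyC /= r_real.
have szs : size (map (@complex.Re R) r) == n.
  by rewrite -eqSS -(size_char_poly A) sE size_prod_XsubC.
exists (Tuple szs); split=> // _ /mapP[z zr ->].
by have := r_gt0 _ zr; rewrite -{1}(r_real _ zr) ltcR.
Qed.

(** By [Bmx_factor], [B F] is a product to which the Rayleigh quotient applies;
    an eigenvalue [z] of [1 + B F] gives its eigenvalue [z - 1], so [z >= 1]. *)
Lemma one_add_BF_split {R : realType} {n : nat} (c : R) (cv : 'I_n -> R) :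
  0 < c -> (forall k, 0 < cv k) ->
  exists s : n.-tuple R,
    has_eigenvalues (1%:M + Bmx R n *m Fmx c cv) s /\
    (forall x, x \in s -> 0 < x).
Proof.
move=> c0 cv0; apply: split_of_positive_spectrum => z /eigenvalueP[v vE v0].
rewrite -(addrNK 1 z) ltr_wpDl ?ltr01 //.
pose toC := real_complex R.
apply: (@eigenvalue_gram_diag_ge0 _ _ _ (map_mx toC (Sigma R n))
  (map_mx toC (\row_j if j == ord_max then n%:R^-1 else 1))
  (map_mx toC (\row_k (c / cv k)))) => [j|i|].
- by rewrite !mxE -[0]/(toC 0) lecR; case: ifP; rewrite ?invr_ge0 ?ler0n.
- by rewrite !mxE -[0]/(toC 0) ltcR divr_gt0.
apply/eigenvalueP; exists v => //.
have -> : map_mx Num.conj (map_mx toC (Sigma R n))^T = map_mx toC (Sigma R n)^T.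
  apply/matrixP=> i j; rewrite !mxE; apply: CrealP.
  by rewrite complex_real.
rewrite -!map_diag_mx -!map_mxM -/(Jlast n n%:R^-1) -Bmx_factor -/(Fmx c cv).
move: vE; rewrite map_mxD map_mx1 mulmxDr mulmx1 scalerBl scale1r => <-.
by rewrite addrC addKr.
Qed.

(** * The spectrum and the kernel of A0 *)

(** With [Y = 'X^2 + omega0^2], the second-order form of [A0] reads
    ['X^n * \det (Y + Q P)] where [Q P] has size [n + 1]. Exchanging the factors
    extracts one factor [Y], which is the mode [a_0 = 1], and leaves
    [P Q = omega0^2 F B], the transpose of [omega0^2 B F]. *)
Lemma char_poly_A0 {R : realType} {n : nat} (c l : R) (cv : 'I_n -> R)
    (s : seq R) :
  (0 < n)%N -> 0 < c -> 0 < l ->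
  has_eigenvalues (1%:M + Bmx R n *m Fmx c cv) s ->
  char_poly (A0 c l cv) =
  'X^n * \prod_(x <- 1 :: s) ('X^2 + (omega0 c l ^+ 2 * x)%:P).
Proof.
move=> n0 c0 l0 sE.
have nR0 : n%:R != 0 :> R by rewrite pnatr_eq0 -lt0n.
set w := omega0 c l ^+ 2.
have wE : w = c^-1 * l^-1.
  by rewrite /w /omega0 exprVn sqr_sqrtr ?mulr_ge0 ?ltW // invfM mulrC.
have w0 : w != 0 by rewrite wE mulf_neq0 ?invr_eq0 ?gt_eqF.
rewrite /A0 -scalemx1 !scale_scalar_mx !mulr1 char_poly_second_order -wE.
congr (_ * _).
set Y := 'X^2 + w%:P; set P := c^-1 *: _; set Q := l^-1 *: _.
have Y0 : Y != 0.
  by rewrite -size_poly_gt0 /Y size_polyDl ?size_polyXn // size_polyC w0.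
have PQ : P *m Q = w *: (Fmx c cv *m Bmx R n).
  rewrite /P /Q -scalemxAl -scalemxAr scalerA -wE; congr (_ *: _).
  rewrite invmx_Jlast // -!mulmxA; congr (_ *m _).
  rewrite Bmx_factor -!mulmxA; congr (_ *m _).
  rewrite !mulmxA !mul_Jlast; congr (Jlast _ _ *m _).
  by ring.
rewrite big_cons mulr1 -/Y; apply: (mulfI (expf_neq0 n Y0)).
rewrite map_mxM det_scalar_addmxC -map_mxM PQ exprSr -mulrA.
congr (_ * (_ * _)).
rewrite -(det_of_spectrum _ w0 sE) -det_tr; congr determinant.
rewrite linearD /= tr_scalar_mx map_trmx linearZ /= trmx_mul tr_diag_mx.
have -> : (Bmx R n)^T = Bmx R n.
  by rewrite Bmx_factor !trmx_mul tr_diag_mx trmxK mulmxA.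
rewrite scalerDr map_mxD scalemx1 map_scalar_mx addrA; congr (_ + _).
by rewrite -raddfD.
Qed.

Lemma conj_pair {R : realType} (b : R) :
  ('X - (0 +i* b)%C%:P) * ('X - (0 -i* b)%C%:P) =
  map_poly (real_complex R) ('X^2 + (b ^+ 2)%:P).
Proof.
have bNb : (0 -i* b)%C = - (0 +i* b)%C.
  by apply/eqP; rewrite eq_complex /= oppr0 !eqxx.
have sqr_ib : (0 +i* b)%C * (0 +i* b)%C = - ((b ^+ 2)%:C)%C.
  by apply/eqP; rewrite eq_complex /=; apply/andP; split; apply/eqP; ring.
rewrite rmorphD /= map_polyXn map_polyC /= bNb polyCN opprK.
by rewrite -subr_sqr !expr2 -polyCM sqr_ib polyCN opprK.
Qed.

(** At [s = 0] the currents vanish and the voltages of the vertical capacitors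
    are free: they determine the remaining voltages. The columns of [W] are the
    solutions for the unit vectors, hence independent by their first block. *)
Lemma A0_kernel {R : realType} {n : nat} (c l : R) (cv : 'I_n -> R) :
  exists v : n.-tuple 'cV[R[i]]_(n + (n.+1 + n.+1)),
    free v /\ (forall x, x \in v -> eigenvector (A0C c l cv) 0 x).
Proof.
pose W : 'M[R]_(n + (n.+1 + n.+1), n) :=
  col_mx 1%:M
    (col_mx (invmx (Jlast n n%:R) *m Jlast n (-1) *m (Sigma R n)^T) 0).
pose V := map_mx (real_complex R) W.
have AV : A0C c l cv *m V = 0.
  rewrite /A0C -map_mxM /A0 /W.
  rewrite mul_block_col mul_row_col mul_col_mx mul_block_col.
  rewrite !mul0mx !mulmx0 !mulmx1 !mulNmx -!scalemxAl !mul1mx add_col_mx !addr0.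
  by rewrite subrr !col_mx0 map_mx0.
have entry (i j : 'I_n) : V (lshift _ i) j = (i == j)%:R.
  by rewrite /V mxE col_mxEu mxE rmorph_nat.
pose v := [tuple col j V | j < n].
exists v; split=> [|_ /mapP[j _ ->]].
- apply/freeP=> k /matrixP sum0 i.
  have v_entry j : (k j *: v`_j) (lshift _ i) 0 = k j * (i == j)%:R.
    by rewrite mxE nth_mktuple mxE entry.
  have := sum0 (lshift _ i) 0.
  rewrite summxE (bigD1 i) //= big1 => [|j ji]; rewrite v_entry.
    by rewrite eqxx mulr1 addr0 mxE.
  by rewrite eq_sym (negPf ji) mulr0.
- split; last by rewrite scale0r colE mulmxA AV mul0mx.
  apply/cV0Pn; exists (lshift _ j).
  by rewrite mxE entry eqxx oner_eq0.
Qed.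

Theorem lemma3 (R : realType) (n : nat) (c l : R) (cv : 'I_n -> R)
    (hn : (1 <= n)%N) (hc : 0 < c) (hl : 0 < l) (hcv : forall k, 0 < cv k) :
  (exists s : n.-tuple R,
      has_eigenvalues (1%:M + Bmx R n *m Fmx c cv) s /\
      (forall x, x \in s -> 0 < x))
  /\
  (forall a : 'I_n.+1 -> R,
      a ord0 = 1 ->
      (forall k : 'I_n, 0 < a (lift ord0 k)) ->
      has_eigenvalues (1%:M + Bmx R n *m Fmx c cv)
        [seq a (lift ord0 k) ^+ 2 | k : 'I_n] ->
      has_eigenvalues (A0C c l cv)
        (nseq n 0
         ++ [seq (0 +i* (omega0 c l * a k))%C | k : 'I_n.+1]
         ++ [seq (0 -i* (omega0 c l * a k))%C | k : 'I_n.+1])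
      /\
      (exists v : n.-tuple 'cV[R[i]]_(n + (n.+1 + n.+1)),
          free v /\
          (forall x, x \in v -> eigenvector (A0C c l cv) 0 x))).
Proof.
split; first exact: one_add_BF_split.
move=> a a0 _ sE; split; last exact: A0_kernel.
rewrite /has_eigenvalues /A0C -map_char_poly (char_poly_A0 hn hc hl sE).
rewrite !big_cat /= big_nseq_cond /= !big_map rmorphM /= map_polyXn.
congr (_ * _).
  by rewrite subr0 iter_mulr_1.
rewrite -big_split /= big_cons big_map !big_enum /= big_ord_recl a0.
rewrite rmorphM rmorph_prod /= !conj_pair !mulr1; congr (_ * _).
by apply: eq_big => // k _; rewrite conj_pair exprMn.
Qed.
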